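(* The sequence $\{x^k\}$ generated by the AdaPBB algorithm (see context) converges to an optimal solution of $\min_{x\in\mathbb{R}^n}F(x)=f(x)+g(x)$.
   Context: $\|\cdot\|$ is the Euclidean norm and $B(x,r)$ the closed ball with center $x$ and radius $r$. Consider $\min_{x\in\mathbb{R}^n}F(x):=f(x)+g(x)$, where $f:\mathbb{R}^n\to\mathbb{R}$ is convex and differentiable with locally Lipschitz gradient and $g:\mathbb{R}^n\to\mathbb{R}\cup\{+\infty\}$ is closed, proper and convex. The set $\mathcal{X}^*$ of minimizers of $F$ is nonempty, $F_*=\min F$, and $x^*\in\mathcal{X}^*$ is fixed. $\mathrm{prox}_{\alpha g}(x)=\arg\min_{y}\,g(y)+\frac1{2\alpha}\|y-x\|^2$. AdaPBB algorithm. Input $x^0\in\mathbb{R}^n$ with a subgradient $\xi^0\in\partial g(x^0)$, $\alpha_0>0$, $\theta_0\ge0$. Set $x^1=\mathrm{prox}_{\alpha_0g}(x^0-\alpha_0\nabla f(x^0))$. For $k=1,2,\dots$ let $\lambda_k=\frac{\langle\nabla f(x^k)-\nabla f(x^{k-1}),x^k-x^{k-1}\rangle}{\|\nabla f(x^k)-\nabla f(x^{k-1})\|^2}$. (Case i) If $\lambda_k\ge\alpha_{k-1}$: $\alpha_k=\sqrt{1+\theta_{k-1}}\,\alpha_{k-1}$, $\theta_k=\alpha_k/\alpha_{k-1}$. (Case ii) If $\alpha_{k-1}/2<\lambda_k<\alpha_{k-1}$: $\alpha_k=\alpha_{k-1}/\sqrt2$, $\theta_k=0$. (Case iii) If $\lambda_k\le\alpha_{k-1}/2$: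 $\alpha_k=\lambda_k/\sqrt2$, $\theta_k=0$. Then $x^{k+1}=\mathrm{prox}_{\alpha_kg}(x^k-\alpha_k\nabla f(x^k))$. It is assumed that $\nabla f(x^k)\ne\nabla f(x^{k-1})$ for all $k\ge1$, so that $\lambda_k$ is well defined. Let $E_1=\frac1{\alpha_0}$ if $\lambda_1\ge\alpha_0$ and $E_1=0$ otherwise. Local smoothness: there is $L>0$ with $f(x)-f(y)-\langle\nabla f(y),x-y\rangle\ge\frac1{2L}\|\nabla f(x)-\nabla f(y)\|^2$ for all $x,y\in B(x^*,T)$, where $T^2=\|x^0-x^*\|^2+2\alpha_0^2\|\nabla f(x^0)+\xi^0\|^2+\max\{2(E_1\alpha_1^2-\alpha_0),0\}(F(x^0)-F_* )$. *)

(* Defs.v *)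
From HB Require Import structures.
From mathcomp Require Import all_boot all_order all_algebra.
From mathcomp Require Import all_classical all_reals all_analysis.

Set Implicit Arguments.
Unset Strict Implicit.
Unset Printing Implicit Defensive.

Import Order.TTheory GRing.Theory Num.Theory.
Import numFieldNormedType.Exports.

Local Open Scope classical_set_scope.
Local Open Scope ring_scope.

(* The norm [`|x|] provided on 'rV[R]_n is the max norm. The Euclidean
   structure is therefore introduced here; the topology, hence convergence and
   differentiability, is the same for both norms. *)
Section euclidean.
Context {R : realType} {n : nat}.
Implicit Types u v : 'rV[R]_n.

Definition dotr u v : R := \sum_(i < n) u ord0 i * v ord0 i.

Definition enorm u : R := Num.sqrt (dotr u u).

Definition ecball (c : 'rV[R]_n) (r : R) : set 'rV[R]_n :=
  [set u | enorm (u - c) <= r].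

Definition gradient (f : 'rV[R]_n -> R) (u : 'rV[R]_n) : 'rV[R]_n :=
  \row_(i < n) 'D_(delta_mx ord0 i) f u.

Definition locally_elipschitz (G : 'rV[R]_n -> 'rV[R]_n) : Prop :=
  forall c, exists r, 0 < r /\ exists M, forall u v,
    ecball c r u -> ecball c r v -> enorm (G u - G v) <= M * enorm (u - v).

End euclidean.

Section extended_valued.
Context {R : realType} {n : nat}.
Implicit Types (g : 'rV[R]_n -> \bar R) (x y : 'rV[R]_n).
Local Open Scope ereal_scope.

(* Together with the properness condition, g takes values in R u {+oo}. *)
Definition eproper g : Prop :=
  (forall x, g x != -oo) /\ exists x, g x < +oo.

(* 0 * +oo = 0 in \bar R, so the endpoints t = 0, 1 are harmless. *)
Definition econvex g : Prop :=
  forall (t : R) x y, (0 <= t <= 1)%R ->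
    g (t *: x + (1 - t) *: y)%R <= t%:E * g x + (1 - t)%:E * g y.

Definition eclosed g : Prop :=
  closed [set p : 'rV[R]_n * R | g p.1 <= p.2%:E].

Definition subdifferential g x : set 'rV[R]_n :=
  [set xi | forall y, g x + (dotr xi (y - x))%:E <= g y].

Definition argmin (h : 'rV[R]_n -> \bar R) : set 'rV[R]_n :=
  [set x | forall y, h x <= h y].

(* The set of proximal points: a singleton when g is closed, proper and
   convex and 0 < a. *)
Definition prox (a : R) g x : set 'rV[R]_n :=
  argmin (fun y => g y + ((2 * a)^-1 * enorm (y - x) ^+ 2)%:E).

End extended_valued.

Section adaPBB.
Context {R : realType} {n : nat}.
Variables (f : 'rV[R]_n -> R) (g : 'rV[R]_n -> \bar R).

Definition objective (y : 'rV[R]_n) : \bar R := ((f y)%:E + g y)%E.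

Definition optval : \bar R := ereal_inf (range objective).

Definition lambda (x : nat -> 'rV[R]_n) (k : nat) : R :=
  dotr (gradient f (x k) - gradient f (x k.-1)) (x k - x k.-1)
  / enorm (gradient f (x k) - gradient f (x k.-1)) ^+ 2.

Record adaPBB (x : nat -> 'rV[R]_n) (xi0 : 'rV[R]_n) (alpha theta : nat -> R)
    : Prop := AdaPBB {
  adaPBB_xi0 : subdifferential g (x 0%N) xi0 ;
  adaPBB_alpha0 : 0 < alpha 0%N ;
  adaPBB_theta0 : 0 <= theta 0%N ;
  adaPBB_prox : forall k : nat,
    prox (alpha k) g (x k - alpha k *: gradient f (x k)) (x k.+1) ;
  adaPBB_case1 : forall k : nat, (1 <= k)%N ->
    alpha k.-1 <= lambda x k ->
    alpha k = Num.sqrt (1 + theta k.-1) * alpha k.-1 /\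
    theta k = alpha k / alpha k.-1 ;
  adaPBB_case2 : forall k : nat, (1 <= k)%N ->
    alpha k.-1 / 2 < lambda x k < alpha k.-1 ->
    alpha k = alpha k.-1 / Num.sqrt 2 /\ theta k = 0 ;
  adaPBB_case3 : forall k : nat, (1 <= k)%N ->
    lambda x k <= alpha k.-1 / 2 ->
    alpha k = lambda x k / Num.sqrt 2 /\ theta k = 0
}.

Definition E1 (x : nat -> 'rV[R]_n) (alpha : nat -> R) : R :=
  if alpha 0%N <= lambda x 1 then (alpha 0%N)^-1 else 0.

(* F(x^0) and min F are finite in the setting where this is used, so that the
   truncation [fine] is immaterial; the radicand is then nonnegative. *)
Definition radiusT (x : nat -> 'rV[R]_n) (xi0 : 'rV[R]_n) (alpha : nat -> R)
    (xs : 'rV[R]_n) : R :=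
  Num.sqrt (enorm (x 0%N - xs) ^+ 2
    + 2 * alpha 0%N ^+ 2 * enorm (gradient f (x 0%N) + xi0) ^+ 2
    + Num.max (2 * (E1 x alpha * alpha 1%N ^+ 2 - alpha 0%N)) 0
      * (fine (objective (x 0%N)) - fine optval)).

Definition smooth_on (L : R) (B : set 'rV[R]_n) : Prop :=
  forall y z, B y -> B z ->
    (2 * L)^-1 * enorm (gradient f y - gradient f z) ^+ 2
      <= f y - f z - dotr (gradient f z) (y - z).

End adaPBB.

(* Main.v *)
Require Import Defs.
From HB Require Import structures.
From mathcomp Require Import all_boot all_order all_algebra.
From mathcomp Require Import ring lra.
From mathcomp Require Import all_classical all_reals all_analysis.

Set Implicit Arguments.
Unset Strict Implicit.
Unset Printing Implicit Defensive.

Import Order.TTheory GRing.Theory Num.Theory.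
Import numFieldNormedType.Exports.

Local Open Scope classical_set_scope.
Local Open Scope ring_scope.

(** Write [w_k] for the subgradient of [F = f + g] at [x k] made of the gradient
    of [f] and of the subgradient of [g] that the previous proximal step
    produces ([residual]). For a minimizer [u], the proximal step gives
      [|x (k+1) - u|^2 + 2 a_k (F (x k) - F u) <= |x k - u|^2 + a_k^2 |w_k|^2]
    ([iterate_step]), so everything rests on controlling the error
    [a_k^2 |w_k|^2]. The stepsize rule is tailored for this. The ratio
    [lambda_k] measures the correlation between the change of the gradient and
    the last displacement [v = (x (k-1) - x k) / a_(k-1)], and [w_k] is the sum
    of [v] and of the change of the gradient. If the step grows, then
    [|w_k|^2 <= <w_k, v>], which is at most a multiple of the decrease of [F]
    ([residual_case1]); otherwise the step is cut so much that
    [2 a_k^2 |w_k|^2 <= a_(k-1)^2 |w_(k-1)|^2] ([residual_halved]). Either way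
      [P_k(u) = |x (k+1) - u|^2 + 2 a_k (1 + theta_k) (F (x k) - F u)
                + a_k^2 |w_k|^2]
    does not increase with [k] ([potential_step]): the growth rule
    [theta_k a_k = (1 + theta_(k-1)) a_(k-1)] is what makes the middle terms
    telescope.

    The radius of the ball on which [f] is smooth is designed to dominate
    [P_1(xs)], so the iterates never leave this ball; there [lambda_k] is at
    least [1 / L], which keeps the stepsizes positive and bounded below. These
    facts depend on each other and are proved by one induction
    ([adaPBB_invariant]).

    At each step [P] decreases at least by [a_k^2 |w_k|^2] or by a multiple of
    [F (x k) - F xs]. As [P] converges and the iterates are bounded, both cases
    force [F (x k)] to tend to the minimum ([gap_cvg0]), and closedness of [g]
    makes every cluster point a minimizer ([cluster_argmin]). Finally, for two
    cluster points [p] and [q] the difference [P_k(p) - P_k(q)] converges, and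
    it is an affine function of [<x (k+1), q - p>] because all the other terms
    cancel; hence [<p, q - p> = <q, q - p>] and [p = q] ([cluster_unique]). The
    cancellation covers the terms that carry the stepsizes, which may be
    unbounded. *)

(** * Euclidean geometry and gradients *)

Section euclidean_theory.
Context {R : realType} {n : nat}.
Implicit Types (u v w : 'rV[R]_n) (a : R).

Lemma dotC u v : dotr u v = dotr v u.
Proof. by apply: eq_bigr => i _; rewrite mulrC. Qed.

Lemma dotDl u v w : dotr (u + v) w = dotr u w + dotr v w.
Proof. by rewrite -big_split; apply: eq_bigr => i _; rewrite mxE mulrDl. Qed.

Lemma dotZl a u w : dotr (a *: u) w = a * dotr u w.
Proof. by rewrite /dotr mulr_sumr; apply: eq_bigr => i _; rewrite mxE mulrA. Qed.

Lemma dotNl u w : dotr (- u) w = - dotr u w.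
Proof. by rewrite -scaleN1r dotZl mulN1r. Qed.

Lemma dotDr u v w : dotr w (u + v) = dotr w u + dotr w v.
Proof. by rewrite dotC dotDl !(dotC w). Qed.

Lemma dotZr a u w : dotr w (a *: u) = a * dotr w u.
Proof. by rewrite dotC dotZl dotC. Qed.

Lemma dotNr u w : dotr w (- u) = - dotr w u.
Proof. by rewrite dotC dotNl dotC. Qed.

Definition dotE := (dotDl, dotDr, dotNl, dotNr, dotZl, dotZr).

Lemma dot_ge0 u : 0 <= dotr u u.
Proof. by apply: sumr_ge0 => i _; rewrite -expr2 sqr_ge0. Qed.

Lemma dot_gt0 u : u != 0 -> 0 < dotr u u.
Proof.
move=> u0; rewrite lt_neqAle dot_ge0 andbT eq_sym; apply: contra u0.
rewrite psumr_eq0 => [/allP z|i _]; last by rewrite -expr2 sqr_ge0.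
apply/eqP/rowP => i; rewrite mxE; apply/eqP.
by have := z i (mem_index_enum i); rewrite /= -expr2 sqrf_eq0.
Qed.

Lemma enorm_sqr u : enorm u ^+ 2 = dotr u u.
Proof. by rewrite sqr_sqrtr ?dot_ge0. Qed.

(** Expand the nonnegative square of [|v|^2 u - <u, v> v]. *)
Lemma cauchy_schwarz u v : dotr u v ^+ 2 <= dotr u u * dotr v v.
Proof.
have [->|/dot_gt0 v0] := eqVneq v 0.
  by rewrite -(scale0r 0) !dotZr !mul0r expr0n mulr0.
have := dot_ge0 (dotr v v *: u - dotr u v *: v).
rewrite !dotE (dotC v u) => h.
rewrite -(ler_pM2l v0); nra.
Qed.

(** The library norm on row vectors is the max norm; this carries Euclidean
    bounds over to the topology. *)
Lemma norm_le_enorm u : `|u| <= enorm u.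
Proof.
rewrite /Num.Def.normr /= mx_normrE; apply/bigmax_leP; split => [|[i j] _ /=].
  exact: sqrtr_ge0.
rewrite (ord1 i) -sqrtr_sqr ler_wsqrtr // /dotr (bigD1 j) //= expr2 lerDl.
by apply: sumr_ge0 => k _; rewrite -expr2 sqr_ge0.
Qed.

Lemma dotr_continuous w : continuous (dotr^~ w : 'rV[R]_n -> R).
Proof.
move=> u; rewrite /dotr; apply: cvg_big => [||i _].
- exact: add_continuous.
- exact: nbhs_filter.
apply: (@continuousM _ _ (fun v => v ord0 i)); last exact: cst_continuous.
exact: coord_continuous.
Qed.

Lemma derive_gradient (f : 'rV[R]_n -> R) u v :
  differentiable f u -> 'D_v f u = dotr (gradient f u) v.
Proof.
move=> df; rewrite deriveE // {1}(row_sum_delta v) linear_sum.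
by apply: eq_bigr => i _; rewrite linearZ /= mxE deriveE // mulrC.
Qed.

(** By convexity the difference quotients of [f] along [v - u] are at most
    [f v - f u] on ]0, 1]; let the parameter tend to 0 from the right. *)
Lemma gradient_inequality (f : 'rV[R]_n -> R) u v :
  convex_function [set: convex_lmodType 'rV[R]_n] f -> differentiable f u ->
  f u + dotr (gradient f u) (v - u) <= f v.
Proof.
move=> cf df; rewrite -lerBrDl -derive_gradient //.
have /cvg_dnbhs_at_right dd := @diff_derivable _ _ _ f u (v - u) df.
apply: (cvgr_to_le dd); near=> t.
have t0 : 0 < t by near: t; exact: nbhs_right_gt.
have t1 : t <= 1 by near: t; exact: nbhs_right_le.
have t01 : 0 <= t <= 1 by rewrite ltW.
have h : f (t *: v + (1 - t) *: u) <= t * f v + (1 - t) * f u.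
  exact: (cf (Itv01 (ltW t0) t1) v u (in_setT _) (in_setT _)).
rewrite [_ *: _]mulrC ler_pdivrMr //= scalerBr -addrA [- _ + u]addrC.
by rewrite scalerBl scale1r in h; lra.
Unshelve. all: by end_near. Qed.

End euclidean_theory.

(** * Subgradients and proximal points *)

Section convex_analysis.
Context {R : realType} {n : nat}.
Implicit Types (g : 'rV[R]_n -> \bar R) (f : 'rV[R]_n -> R) (u p z : 'rV[R]_n).

Lemma proper_fin_num g u (r : R) :
  eproper g -> (g u <= r%:E)%E -> g u \is a fin_num.
Proof.
move=> [gN _] gr; rewrite fin_numE gN /=.
by apply: contraL gr => /eqP ->; rewrite leye_eq.
Qed.

Lemma proper_point g : eproper g -> exists u, g u \is a fin_num.
Proof.
by case=> gN [u gu]; exists u; rewrite fin_numE gN /= lt_eqF.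
Qed.

(** An infinite value at [u] would propagate to every point through the
    subgradient inequality, against properness. *)
Lemma subdifferential_fin_num g u xi :
  eproper g -> subdifferential g u xi -> g u \is a fin_num.
Proof.
move=> gp sub; have [v gv] := proper_point gp.
apply: (@proper_fin_num _ _ (fine (g v) - dotr xi (v - u))) => //.
by rewrite EFinB leeBrDr // fineK //; exact: sub.
Qed.

Lemma subdifferential_le g u v xi : eproper g -> subdifferential g u xi ->
  g v \is a fin_num -> fine (g u) + dotr xi (v - u) <= fine (g v).
Proof.
move=> gp sub gv; have gu := subdifferential_fin_num gp sub.
by rewrite -lee_fin EFinD !fineK //; exact: sub.
Qed.

Lemma argmin_objective_fin_num f g u :
  eproper g -> argmin (objective f g) u -> g u \is a fin_num.
Proof.
move=> gp umin; have [v gv] := proper_point gp.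
apply: (@proper_fin_num _ _ (f v + fine (g v) - f u)) => //.
by rewrite EFinB EFinD leeBrDr // fineK // [leLHS]addeC; exact: umin.
Qed.

Lemma optvalE f g u : argmin (objective f g) u -> optval f g = objective f g u.
Proof.
move=> umin; apply/eqP; rewrite eq_le; apply/andP; split.
  by apply: ereal_inf_lbound; exists u.
by apply: le_ereal_inf_tmp => _ [v _ <-]; exact: umin.
Qed.

(** This replaces a passage to the limit [t -> 0] in first-order optimality
    conditions. *)
Lemma affine_ge0 (c K : R) : 0 <= K ->
  (forall t, 0 < t <= 1 -> 0 <= c + t * K) -> 0 <= c.
Proof.
move=> K0 h; rewrite leNgt; apply/negP => c0.
have Kc : 0 < K - c by lra.
(* at this t the affine function equals - c ^+ 2 / (K - c) < 0 *)
have := h (- c / (K - c)).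
rewrite divr_gt0 ?oppr_gt0 //= ler_pdivrMr // mul1r => /(_ ltac:(lra)).
have -> : c + - c / (K - c) * K = - c ^+ 2 / (K - c) by field; rewrite gt_eqF.
by rewrite mulNr oppr_ge0 leNgt divr_gt0 // exprn_even_gt0 //= lt_eqF.
Qed.

Lemma prox_fin_num g a z p : eproper g -> prox a g z p -> g p \is a fin_num.
Proof.
move=> gp pmin; have [v gv] := proper_point gp.
apply: (@proper_fin_num _ _ (fine (g v) + (2 * a)^-1 * enorm (v - z) ^+ 2
  - (2 * a)^-1 * enorm (p - z) ^+ 2)) => //.
by rewrite EFinB leeBrDr // EFinD fineK //; exact: pmin.
Qed.

(** Compare the value at [p] with the value at [t y + (1 - t) p]: convexity of
    [g] leaves an inequality whose first-order part in [t] is the subgradient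
    inequality. *)
Lemma prox_subdifferential g a z p : eproper g -> econvex g -> 0 < a ->
  prox a g z p -> subdifferential g p (a^-1 *: (z - p)).
Proof.
move=> gp gc a0 pmin y.
have gpf := prox_fin_num gp pmin.
have [gy|gy] := boolP (g y \is a fin_num); last first.
  move: gy; rewrite fin_numE gp.1 /= negbK => /eqP ->; exact: leey.
rewrite -(fineK gpf) -(fineK gy) -EFinD lee_fin -subr_ge0.
apply: (@affine_ge0 _ ((2 * a)^-1 * dotr (y - p) (y - p))).
  by rewrite mulr_ge0 ?dot_ge0 // invr_ge0 mulr_ge0 // ltW.
move=> t /andP[t0 t1].
pose yt := t *: y + (1 - t) *: p.
have h : fine (g p) + (2 * a)^-1 * enorm (p - z) ^+ 2 <=
    t * fine (g y) + (1 - t) * fine (g p) + (2 * a)^-1 * enorm (yt - z) ^+ 2.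
  rewrite -lee_fin EFinD fineK //; apply: (le_trans (pmin yt)).
  rewrite [in leRHS]EFinD leeD2r // EFinD !EFinM !fineK //.
  by apply: gc; rewrite ltW.
have ytz : yt - z = (p - z) + t *: (y - p) by
  apply/rowP => i; rewrite !mxE; ring.
rewrite -(ler_pM2l t0) mulr0; move: h.
rewrite ytz !enorm_sqr !dotE (dotC z p) (dotC p y) (dotC z y) invfM.
by set b := a^-1; lra.
Qed.

End convex_analysis.

(** * One step in inner-product form *)

Section step_inequalities.
Context {R : realType} {n : nat}.
Implicit Types (c d u v w y p xi eta : 'rV[R]_n) (a lam : R).

(** A forward-backward step from [y] to [p], where [c] stands for the gradient
    of [f] at [y], and [xi], [eta] for subgradients of [G] at [y] and at [p].
    Expanding [|p - u|^2], the slack in the conclusion is [a^2 |eta - xi|^2]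
    plus [2 a] times the slacks of the three subgradient inequalities. *)
Lemma forward_backward_step (f G : 'rV[R]_n -> R) a c xi eta u y p :
    0 < a -> p = y - a *: (c + eta) ->
    f y + dotr c (u - y) <= f u ->
    G y + dotr xi (p - y) <= G p ->
    G p + dotr eta (u - p) <= G u ->
  enorm (p - u) ^+ 2 + 2 * a * (f y + G y - (f u + G u))
    <= enorm (y - u) ^+ 2 + a ^+ 2 * enorm (c + xi) ^+ 2.
Proof.
move=> a0 -> hf hxi heta; rewrite !enorm_sqr.
move: (ler_wpM2l (ltW a0) hf) (ler_wpM2l (ltW a0) hxi).
move: (ler_wpM2l (ltW a0) heta).
have := mulr_ge0 (sqr_ge0 a) (dot_ge0 (eta - xi)).
rewrite !dotE (dotC xi eta) (dotC eta c) (dotC xi c) (dotC c y) (dotC c u).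
rewrite (dotC eta y) (dotC eta u) (dotC xi y) (dotC u y); lra.
Qed.

(** Monotonicity of the subdifferential gives [<c + eta, eta - xi> <= 0], so
    replacing the old subgradient [xi] by the new one [eta] does not lengthen
    [c + xi]. *)
Lemma prox_displacement_le (G : 'rV[R]_n -> R) a c xi eta y p :
    0 < a -> p = y - a *: (c + eta) ->
    G y + dotr xi (p - y) <= G p ->
    G p + dotr eta (y - p) <= G y ->
  enorm (c + eta) ^+ 2 <= enorm (c + xi) ^+ 2.
Proof.
move=> a0 -> hxi heta; rewrite !enorm_sqr -(ler_pM2l a0).
have := mulr_ge0 (ltW a0) (dot_ge0 (eta - xi)); move: hxi heta.
rewrite !dotE (dotC xi eta) (dotC eta c) (dotC xi c) (dotC eta y) (dotC xi y).
lra.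
Qed.

(** In the next three lemmas [v] is the last displacement divided by [- a], [d]
    the change of the gradient, [lam] the Barzilai-Borwein stepsize and [v + d]
    the new residual; the equation on [lam] is its definition. When
    [a <= lam], it says that [d] is not positively correlated with [v + d]. *)
Lemma residual_case1 a lam v d : 0 < a ->
    lam * dotr d d = - (a * dotr d v) -> a <= lam ->
  enorm (v + d) ^+ 2 <= dotr (v + d) v.
Proof.
move=> a0 hd alam; rewrite enorm_sqr -(ler_pM2l a0) !dotE (dotC v d).
by have := ler_wpM2r (dot_ge0 d) alam; lra.
Qed.

(** Here [2 <d, v> + |d|^2 <= 0]. *)
Lemma residual_case2 a lam v d : 0 < a ->
    lam * dotr d d = - (a * dotr d v) -> a / 2 < lam ->
  enorm (v + d) ^+ 2 <= enorm v ^+ 2.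
Proof.
move=> a0 hd alam; rewrite !enorm_sqr -(ler_pM2l a0) !dotE (dotC v d).
by have := ler_wpM2r (dot_ge0 d) (ltW alam); lra.
Qed.

(** The square [|a v + lam d|^2] equals [a^2 |v|^2 - lam^2 |d|^2], which bounds
    [|d|] by [|v|]; the coefficient that then remains in front of [|v|^2] is
    [(a - lam)^2], which is at most [a^2]. *)
Lemma residual_case3 a lam v d : 0 < a -> 0 < lam ->
    lam * dotr d d = - (a * dotr d v) -> lam <= a / 2 ->
  lam ^+ 2 * enorm (v + d) ^+ 2 <= a ^+ 2 * enorm v ^+ 2.
Proof.
move=> a0 lam0 hd alam; rewrite !enorm_sqr -(ler_pM2l a0) !dotE (dotC v d).
have h1 : lam ^+ 2 * dotr d d <= a ^+ 2 * dotr v v.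
  have := dot_ge0 (a *: v + lam *: d); rewrite !dotE (dotC v d) => h.
  have := congr1 ( *%R lam) hd; lra.
have h2 := congr1 ( *%R (lam ^+ 2)) hd.
have h3 : 0 <= a - 2 * lam by lra.
have h4 := ler_wpM2l h3 h1.
have h5 : 0 <= a * lam * (2 * a - lam) * dotr v v.
  by rewrite !mulr_ge0 ?dot_ge0 ?ltW //; lra.
lra.
Qed.

End step_inequalities.

(** * Cluster points of bounded sequences *)

(** A cluster point is a limit along a finer filter, along which [phi] still
    tends to [l]. *)
Lemma cluster_cvg_eq (T U : topologicalType) (F : set_system T) (phi : T -> U)
    (p : T) (l : U) : hausdorff_space U -> Filter F ->
  cluster F p -> {for p, continuous phi} -> phi @ F --> l -> phi p = l.
Proof.
move=> hU FF; rewrite cluster_cvgE => -[G PG [Gp FG]] cphi Fl.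
have Gl : phi @ G --> l by move=> A /Fl; exact: FG.
apply: (@cvg_unique _ hU (phi @ G)) => //=; exact: continuous_cvg cphi Gp.
Qed.

Lemma bounded_cvg_unique_cluster (R : realType) (n : nat)
    (u : nat -> 'rV[R]_n) (M : R) :
    (forall k, `|u k| <= M) ->
    (forall p q, cluster (u @ \oo) p -> cluster (u @ \oo) q -> p = q) ->
  exists2 p, cluster (u @ \oo) p & u @ \oo --> p.
Proof.
move=> uM uniq.
have cpt p r : 0 < r -> compact (closed_ball p r : set 'rV[R]_n).
  move=> r0; apply: bounded_closed_compact; last exact: closed_ball_closed.
  exists (`|p| + r); split; first exact: num_real.
  move=> K /ltW rK y; rewrite closed_ballE // /closed_ball_ /= => h.
  apply: le_trans rK.
  by rewrite -(subrK p y) addrC (le_trans (ler_normD _ _)) // lerD2l distrC.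
have M0 : 0 <= M by apply: le_trans (uM 0%N); exact: normr_ge0.
have inball p : (u @ \oo) (closed_ball p (`|p| + M + 1)).
  exists 0%N => // k _ /=; rewrite closed_ballE ?ltr_wpDl ?addr_ge0 //.
  rewrite /closed_ball_ /= (le_trans (ler_normB _ _)) // -addrA lerD2l.
  by rewrite (le_trans (uM k)) // lerDl.
have rpos (p : 'rV[R]_n) : 0 < `|p| + M + 1 by rewrite ltr_wpDl ?addr_ge0.
have [p [_ cp]] := cpt 0 _ (rpos 0) (u @ \oo) _ (inball 0).
exists p => //.
apply: (compact_cluster_set1 _ (cpt p _ (rpos p)) _ _ (inball p)).
- exact: norm_hausdorff.
- by apply/nbhs_closedballP; exists (PosNum (rpos p)).
- rewrite eqEsubset; split=> [q cq|_ ->] //=; exact: uniq.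
Qed.

(** * Lyapunov function of the iterates *)

(** The objective in real arithmetic: it agrees with [objective f g] wherever
    [g] is finite, hence at all iterates and minimizers. *)
Definition real_objective {R : realType} {n : nat} (f : 'rV[R]_n -> R)
  (g : 'rV[R]_n -> \bar R) (u : 'rV[R]_n) : R := f u + fine (g u).

Section adaPBB_analysis.
Context {R : realType} {n : nat}.
Variables (f : 'rV[R]_n -> R) (g : 'rV[R]_n -> \bar R).
Hypotheses (f_convex : convex_function [set: convex_lmodType 'rV[R]_n] f)
  (f_diff : forall y, differentiable f y)
  (g_proper : eproper g) (g_convex : econvex g).
Variables (x : nat -> 'rV[R]_n) (xi0 : 'rV[R]_n) (alpha theta : nat -> R).
Hypotheses (algo : adaPBB f g x xi0 alpha theta)
  (grad_neq : forall k : nat, (1 <= k)%N ->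
    gradient f (x k) <> gradient f (x k.-1)).
Implicit Types (u : 'rV[R]_n) (k : nat).

Local Notation F := (real_objective f g).

(** For [k > 0], the subgradient of [g] at [x k] given by the optimality
    condition of the proximal step that produced [x k]. *)
Definition bb_subgradient k : 'rV[R]_n :=
  if k is j.+1 then (alpha j)^-1 *: (x j - x j.+1) - gradient f (x j) else xi0.

Definition residual k := gradient f (x k) + bb_subgradient k.

(** The Lyapunov function relative to a minimizer [u]. The weight [1 + theta k]
    is the one that the growth rule turns into
    [alpha k.+1 * theta k.+1 / alpha k]. *)
Definition potential u k : R :=
  enorm (x k.+1 - u) ^+ 2 + 2 * alpha k * (1 + theta k) * (F (x k) - F u)
  + alpha k ^+ 2 * enorm (residual k) ^+ 2.

Lemma iterate_fin_num k : g (x k) \is a fin_num.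
Proof.
case: k => [|k]; first exact: subdifferential_fin_num (adaPBB_xi0 algo).
exact: prox_fin_num (adaPBB_prox algo k).
Qed.

Lemma bb_subgradientP k :
  0 < alpha k.-1 -> subdifferential g (x k) (bb_subgradient k).
Proof.
case: k => [_|k /= a0]; first exact: adaPBB_xi0 algo.
have := prox_subdifferential g_proper g_convex a0 (adaPBB_prox algo k).
congr subdifferential; apply/rowP => i; rewrite !mxE; field.
by rewrite gt_eqF.
Qed.

Lemma bb_subgradient_le k u : 0 < alpha k.-1 -> g u \is a fin_num ->
  fine (g (x k)) + dotr (bb_subgradient k) (u - x k) <= fine (g u).
Proof.
by move=> a0; apply: subdifferential_le => //; exact: bb_subgradientP.
Qed.

Lemma gap_le_residual k u : 0 < alpha k.-1 -> g u \is a fin_num ->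
  F (x k) - F u <= dotr (residual k) (x k - u).
Proof.
move=> a0 gu; have := bb_subgradient_le a0 gu.
have := gradient_inequality u f_convex (f_diff (x k)).
by rewrite /real_objective /residual -(opprB u) !(dotNr, dotDl); lra.
Qed.

Lemma iterateS k : 0 < alpha k ->
  x k.+1 = x k - alpha k *: (gradient f (x k) + bb_subgradient k.+1).
Proof.
move=> a0; apply/rowP => i; rewrite /= !mxE; field.
by rewrite gt_eqF.
Qed.

Lemma iterate_step k u : 0 < alpha k.-1 -> 0 < alpha k -> g u \is a fin_num ->
  enorm (x k.+1 - u) ^+ 2 + 2 * alpha k * (F (x k) - F u)
    <= enorm (x k - u) ^+ 2 + alpha k ^+ 2 * enorm (residual k) ^+ 2.
Proof.
move=> a0' a0 gu.
apply: (@forward_backward_step _ _ _ (fine \o g) _ _ _ _ _ _ _ a0 (iterateS a0)).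
- exact: gradient_inequality.
- by apply: bb_subgradient_le => //; exact: iterate_fin_num.
- exact: bb_subgradient_le.
Qed.

(** As [x k.+1 - x k] is [- alpha k] times the normalized displacement, this is
    the definition of [lambda] with the denominator cleared. *)
Lemma lambdaM k : 0 < alpha k ->
  let d := gradient f (x k.+1) - gradient f (x k) in
  lambda f x k.+1 * dotr d d
    = - (alpha k * dotr d ((alpha k)^-1 *: (x k - x k.+1))).
Proof.
move=> a0 d; rewrite /lambda /= -/d enorm_sqr mulfVK; last first.
  rewrite gt_eqF // dot_gt0 // subr_eq0; apply/eqP.
  exact: (grad_neq (k := k.+1)).
by rewrite dotZr mulrA divff ?gt_eqF // mul1r -dotNr opprB.
Qed.

Lemma residualS k :
  residual k.+1 = (alpha k)^-1 *: (x k - x k.+1)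
    + (gradient f (x k.+1) - gradient f (x k)).
Proof. by apply/rowP => i; rewrite !mxE; ring. Qed.

Lemma displacement_le k : 0 < alpha k.-1 -> 0 < alpha k ->
  enorm ((alpha k)^-1 *: (x k - x k.+1)) ^+ 2 <= enorm (residual k) ^+ 2.
Proof.
move=> a0' a0.
have -> : (alpha k)^-1 *: (x k - x k.+1)
    = gradient f (x k) + bb_subgradient k.+1 by rewrite /= [RHS]addrC subrK.
apply: (@prox_displacement_le _ _ (fine \o g) _ _ _ _ _ _ a0 (iterateS a0)).
- by apply: bb_subgradient_le => //; exact: iterate_fin_num.
- by apply: bb_subgradient_le => //; exact: iterate_fin_num.
Qed.

Lemma stepsize_growth k : alpha k <= lambda f x k.+1 ->
  alpha k.+1 = Num.sqrt (1 + theta k) * alpha k /\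
  theta k.+1 = alpha k.+1 / alpha k.
Proof. exact: (adaPBB_case1 algo (k := k.+1)). Qed.

Lemma stepsize_growthM k : 0 < alpha k -> 0 <= theta k ->
    alpha k <= lambda f x k.+1 ->
  alpha k.+1 * theta k.+1 = alpha k * (1 + theta k).
Proof.
move=> a0 t0 /stepsize_growth[-> ->]; rewrite mulfK ?gt_eqF // mulrAC -expr2.
by rewrite sqr_sqrtr 1?mulrC // addr_ge0.
Qed.

Lemma sqr_div_sqrt2 (a : R) : (a / Num.sqrt 2) ^+ 2 = a ^+ 2 / 2.
Proof. by rewrite expr_div_n sqr_sqrtr. Qed.

(** Both shrinking rules cut the step by an extra factor [sqrt 2], which squares
    to the 2 on the left-hand side. That factor is the room needed to
    pay for the new error term and keep one copy of it in the potential. *)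
Lemma residual_halved k : 0 < alpha k.-1 -> 0 < alpha k -> 0 < alpha k.+1 ->
    lambda f x k.+1 < alpha k ->
  theta k.+1 = 0 /\
  2 * alpha k.+1 ^+ 2 * enorm (residual k.+1) ^+ 2
    <= alpha k ^+ 2 * enorm (residual k) ^+ 2.
Proof.
move=> a0' a0 a1 la.
have dis := ler_wpM2l (sqr_ge0 (alpha k)) (displacement_le a0' a0).
have lM := lambdaM a0.
have [le|gt] := leP (lambda f x k.+1) (alpha k / 2).
  have [aE ->] := adaPBB_case3 algo (k := k.+1) isT le; split => //.
  have l0 : 0 < lambda f x k.+1.
    by move: a1; rewrite aE pmulr_lgt0 // invr_gt0 sqrtr_gt0.
  have := residual_case3 a0 l0 lM le; rewrite -residualS aE sqr_div_sqrt2.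
  lra.
have [|aE ->] := adaPBB_case2 algo (k := k.+1) isT; first by rewrite gt.
split => //; have := residual_case2 a0 lM gt.
rewrite -residualS aE sqr_div_sqrt2 => h.
by have := ler_wpM2l (sqr_ge0 (alpha k)) h; lra.
Qed.

(** The decrease is an error term when the step grows and a function-value gap
    when it shrinks. When it grows, the new error occurs twice, once through
    [iterate_step] and once in the potential, and the weight [1 + theta k] lets
    the decrease of [F] from [x k] to [x k.+1] absorb both copies. *)
Lemma potential_step u k : 0 < alpha k.-1 -> 0 < alpha k -> 0 < alpha k.+1 ->
    0 <= theta k -> g u \is a fin_num ->
  potential u k.+1 + (if alpha k <= lambda f x k.+1
    then alpha k ^+ 2 * enorm (residual k) ^+ 2
    else 2 * alpha k * (1 + theta k) * (F (x k) - F u)) <= potential u k.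
Proof.
move=> a0' a0 a1 t0 gu; have := @iterate_step k.+1 u a0 a1 gu; rewrite /potential.
case: ifPn => [al|]; last first.
  by rewrite -ltNge => la; have [-> ] := residual_halved a0' a0 a1 la; lra.
have aE := stepsize_growthM a0 t0 al.
have lM := lambdaM a0.
have h := residual_case1 a0 lM al; rewrite -residualS in h.
have := gap_le_residual (k := k.+1) a0 (iterate_fin_num k).
have h2 : alpha k.+1 ^+ 2 * enorm (residual k.+1) ^+ 2
   <= alpha k.+1 * theta k.+1 * dotr (residual k.+1) (x k - x k.+1).
  have [_ tE] := stepsize_growth al.
  move: h; rewrite dotZr => /(ler_wpM2l (sqr_ge0 (alpha k.+1))).
  by move=> h1; apply: le_trans h1 _; rewrite tE expr2 !mulrA.
rewrite -(opprB (x k)) dotNr => h3.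
have c0 : 0 <= alpha k * (1 + theta k) by rewrite mulr_ge0 ?addr_ge0 // ltW.
have := ler_wpM2l c0 h3; have := congr1 ( *%R^~ (F (x k.+1) - F u)) aE.
by rewrite aE in h2 => /=; lra.
Qed.

Lemma real_objective_le u v : argmin (objective f g) u -> g v \is a fin_num ->
  F u <= F v.
Proof.
move=> umin gv; have gu := argmin_objective_fin_num g_proper umin.
by rewrite -lee_fin !EFinD !fineK //; exact: umin.
Qed.

Lemma gap_ge0 u k : argmin (objective f g) u -> 0 <= F (x k) - F u.
Proof.
by move=> umin; rewrite subr_ge0 real_objective_le //; exact: iterate_fin_num.
Qed.

Lemma distance_le_potential u k : argmin (objective f g) u ->
  0 <= alpha k -> 0 <= theta k -> enorm (x k.+1 - u) ^+ 2 <= potential u k.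
Proof.
move=> umin a0 t0; rewrite /potential -addrA lerDl addr_ge0 //.
  by rewrite !mulr_ge0 ?gap_ge0 ?addr_ge0.
by rewrite mulr_ge0 ?sqr_ge0.
Qed.

(** * Confinement to the ball of smoothness *)

Variables (xs : 'rV[R]_n) (L : R).
Hypotheses (xs_min : argmin (objective f g) xs) (L_gt0 : 0 < L)
  (f_smooth : smooth_on f L (ecball xs (radiusT f g x xi0 alpha xs))).

(** The square of the radius, with real values of the objective. *)
Let T2 : R := enorm (x 0%N - xs) ^+ 2
    + 2 * alpha 0%N ^+ 2 * enorm (gradient f (x 0%N) + xi0) ^+ 2
    + Num.max (2 * (E1 f x alpha * alpha 1%N ^+ 2 - alpha 0%N)) 0
      * (F (x 0%N) - F xs).

Let radiusE : radiusT f g x xi0 alpha xs = Num.sqrt T2.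
Proof.
have gxs := argmin_objective_fin_num g_proper xs_min.
rewrite /radiusT (optvalE xs_min) /objective -(fineK gxs).
by rewrite -(fineK (iterate_fin_num 0%N)).
Qed.

Let ballP y : enorm (y - xs) ^+ 2 <= T2 ->
  ecball xs (radiusT f g x xi0 alpha xs) y.
Proof.
rewrite radiusE /ecball /= enorm_sqr => h.
exact: ler_wsqrtr.
Qed.

(** Adding the smoothness inequality to itself with the two points exchanged
    gives cocoercivity of the gradient between consecutive iterates. *)
Lemma inv_smoothness_le_lambda k :
  enorm (x k - xs) ^+ 2 <= T2 -> enorm (x k.+1 - xs) ^+ 2 <= T2 ->
  L^-1 <= lambda f x k.+1.
Proof.
move=> /ballP b0 /ballP b1; rewrite /lambda /= ler_pdivlMr; last first.
  rewrite enorm_sqr dot_gt0 // subr_eq0; apply/eqP.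
  exact: (grad_neq (k := k.+1)).
move: (f_smooth b0 b1) (f_smooth b1 b0); rewrite !enorm_sqr !dotE invfM.
rewrite (dotC (gradient f (x k)) (gradient f (x k.+1))); lra.
Qed.

(** As [lambda] is at least [L^-1], no shrinking rule goes below [L^-1 / sqrt 2]. *)
Let m := Num.min (alpha 0%N) (L^-1 / Num.sqrt 2).

Lemma stepsize_bound_gt0 : 0 < m.
Proof.
by rewrite /m lt_min (adaPBB_alpha0 algo) divr_gt0 ?invr_gt0 ?sqrtr_gt0.
Qed.

Lemma stepsize_ge_step k : m <= alpha k -> 0 <= theta k ->
  L^-1 <= lambda f x k.+1 -> m <= alpha k.+1 /\ 0 <= theta k.+1.
Proof.
move=> ma t0 Ll; have a0 := lt_le_trans stepsize_bound_gt0 ma.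
have mL : m <= L^-1 / Num.sqrt 2 by rewrite /m ge_min lexx orbT.
have s2 : 0 < (Num.sqrt 2 : R)^-1 by rewrite invr_gt0 sqrtr_gt0.
have [al|la] := leP (alpha k) (lambda f x k.+1).
  have [-> ->] := stepsize_growth al; split; last first.
    by rewrite divr_ge0 ?mulr_ge0 ?sqrtr_ge0 // ltW.
  apply: (le_trans ma); rewrite ler_peMl ?(ltW a0) //.
  by rewrite -[leLHS]sqrtr1 ler_wsqrtr // lerDl.
have [le|gt] := leP (lambda f x k.+1) (alpha k / 2).
  have [-> ->] := adaPBB_case3 algo (k := k.+1) isT le; split => //.
  by apply: (le_trans mL); rewrite ler_pM2r.
have [|-> ->] := adaPBB_case2 algo (k := k.+1) isT; first by rewrite gt.
split => //; apply: (le_trans mL); rewrite ler_pM2r //.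
exact: le_trans (ltW la).
Qed.

(** The maximum in the radius accounts for [2 a_0 theta_0] times the initial gap,
    which is left over when the first step grows; then [E1] is [1 / a_0] and
    [a_1^2 / a_0 = a_0 (1 + theta_0)]. *)
Lemma potential1_le : 0 < alpha 1%N -> potential xs 1%N <= T2.
Proof.
move=> a1; have a0 := adaPBB_alpha0 algo; have t0 := adaPBB_theta0 algo.
have gxs := argmin_objective_fin_num g_proper xs_min.
have := potential_step (k := 0%N) a0 a0 a1 t0 gxs.
have := iterate_step (k := 0%N) a0 a0 gxs.
have := mulr_ge0 (sqr_ge0 (alpha 0%N)) (sqr_ge0 (enorm (residual 0%N))).
have D0 := gap_ge0 0%N xs_min.
rewrite /potential /T2 /residual /= /E1.
case: ifPn => [al h0 h1 h2|_ h0 h1 h2].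
  have h3 : (alpha 0%N)^-1 * alpha 1%N ^+ 2 = alpha 0%N * (1 + theta 0%N).
    rewrite -(stepsize_growthM a0 t0 al) (stepsize_growth al).2.
    by rewrite mulrA -expr2 mulrC.
  have h4 := ler_wpM2r D0 (_ : 2 * (alpha 0%N * (1 + theta 0%N) - alpha 0%N) <=
    Num.max (2 * (alpha 0%N * (1 + theta 0%N) - alpha 0%N)) 0).
  rewrite h3; move: h4; rewrite le_max lexx => /(_ isT); lra.
have h4 := ler_wpM2r D0 (_ : 0 <=
    Num.max (2 * (0 * alpha 1%N ^+ 2 - alpha 0%N)) 0).
have := mulr_ge0 (ltW a0) D0.
move: h4; rewrite le_max lexx orbT => /(_ isT); lra.
Qed.

(** The stepsize bound at [k + 1] needs [x k] and [x (k+1)] in the ball, and the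
    ball at [x (k+2)] needs the potential at [k + 1], which needs a positive
    stepsize: the induction interleaves the two. The potential is compared with
    the radius from index 1 on only: when the first step shrinks, the radius
    does not account for the term in [theta 0] of the potential at 0. *)
Lemma adaPBB_invariant k :
  [/\ m <= alpha k.-1 /\ m <= alpha k, 0 <= theta k,
      enorm (x k - xs) ^+ 2 <= T2, enorm (x k.+1 - xs) ^+ 2 <= T2
    & (0 < k)%N -> potential xs k <= T2].
Proof.
have a0 := adaPBB_alpha0 algo; have m0 := stepsize_bound_gt0.
have gxs := argmin_objective_fin_num g_proper xs_min.
elim: k => [|k [[ma' ma] t0 b0 b1 pT]] /=.
  have ma : m <= alpha 0%N by rewrite /m ge_min lexx.
  have D0 := gap_ge0 0%N xs_min.
  have TT : enorm (x 0%N - xs) ^+ 2 + 2 * alpha 0%N ^+ 2 *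
      enorm (residual 0%N) ^+ 2 <= T2.
    by rewrite /T2 lerDl mulr_ge0 // le_max lexx orbT.
  have w0 : 0 <= alpha 0%N ^+ 2 * enorm (residual 0%N) ^+ 2.
    by rewrite mulr_ge0 ?sqr_ge0.
  split => //; first exact: adaPBB_theta0 algo.
    by apply: le_trans TT; lra.
  have := iterate_step (k := 0%N) a0 a0 gxs; have := mulr_ge0 (ltW a0) D0; lra.
have [ma1 t1] := stepsize_ge_step ma t0 (inv_smoothness_le_lambda b0 b1).
have a1 := lt_le_trans m0 ma1.
have pT1 : potential xs k.+1 <= T2.
  case: k => [|k] in ma' ma t0 b0 b1 pT ma1 t1 a1 *; first exact: potential1_le.
  apply: (le_trans _ (pT isT)).
  have := potential_step (lt_le_trans m0 ma') (lt_le_trans m0 ma) a1 t0 gxs.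
  apply: le_trans; rewrite lerDl; case: ifP => _.
    by rewrite mulr_ge0 ?sqr_ge0.
  by rewrite !mulr_ge0 ?gap_ge0 ?addr_ge0 // ltW // (lt_le_trans m0 ma).
split => //; apply: le_trans pT1; apply: distance_le_potential => //.
exact: ltW.
Qed.

(** * Convergence *)

Lemma stepsize_gt0 k : 0 < alpha k.
Proof.
have [[_ ma] _ _ _ _] := adaPBB_invariant k.
exact: lt_le_trans stepsize_bound_gt0 ma.
Qed.

Lemma potential_decreases u k : argmin (objective f g) u ->
  potential u k.+1 + (if alpha k <= lambda f x k.+1
    then alpha k ^+ 2 * enorm (residual k) ^+ 2
    else 2 * alpha k * (1 + theta k) * (F (x k) - F u)) <= potential u k.
Proof.
move=> umin; have [_ t0 _ _ _] := adaPBB_invariant k.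
apply: potential_step => //; try exact: stepsize_gt0.
exact: argmin_objective_fin_num umin.
Qed.

Lemma potential_cvg u : argmin (objective f g) u -> cvgn (potential u).
Proof.
move=> umin; apply: nonincreasing_is_cvgn.
  apply/nonincreasing_seqP => k; apply: le_trans (potential_decreases k umin).
  have [_ t0 _ _ _] := adaPBB_invariant k; rewrite lerDl.
  case: ifP => _; first by rewrite mulr_ge0 ?sqr_ge0.
  by rewrite !mulr_ge0 ?gap_ge0 ?addr_ge0 ?(ltW (stepsize_gt0 _)).
exists 0 => _ [k _ <-]; have [_ t0 _ _ _] := adaPBB_invariant k.
apply: le_trans (distance_le_potential umin (ltW (stepsize_gt0 k)) t0).
exact: sqr_ge0.
Qed.

(** If the decrease [delta] pays for [a_k^2 |w_k|^2], then the gap, at most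
    [<w_k, x k - xs>], is bounded by Cauchy-Schwarz on the ball, which yields
    [delta T2]; if it pays for the gap directly, one gets [delta^2]. The sum of
    the two bounds covers both cases. *)
Lemma gap_sqr_le k :
  (m * (F (x k) - F xs)) ^+ 2 <= (potential xs k - potential xs k.+1)
    * (T2 + (potential xs k - potential xs k.+1)).
Proof.
set delta := potential xs k - potential xs k.+1.
have [[_ ma] t0 b0 _ _] := adaPBB_invariant k.
have gxs := argmin_objective_fin_num g_proper xs_min.
have m0 := stepsize_bound_gt0; have a0 := stepsize_gt0 k.
have D0 := gap_ge0 k xs_min; have T0 : 0 <= T2 := le_trans (sqr_ge0 _) b0.
have := potential_decreases k xs_min; rewrite -lerBrDl -/delta.
case: ifP => _ hd; last first.
  have md : m * (F (x k) - F xs) <= delta.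
    apply: le_trans hd; rewrite ler_wpM2r //.
    have := mulr_ge0 (ltW a0) t0; lra.
  have mD0 : 0 <= m * (F (x k) - F xs) by rewrite mulr_ge0 // ltW.
  have d0 := le_trans mD0 md.
  have : (m * (F (x k) - F xs)) ^+ 2 <= delta ^+ 2 by rewrite ler_sqr.
  have := mulr_ge0 d0 T0; lra.
have DW : (F (x k) - F xs) ^+ 2 <= enorm (residual k) ^+ 2 * T2.
  apply: (@le_trans _ _ (dotr (residual k) (x k - xs) ^+ 2)).
    have h := gap_le_residual (stepsize_gt0 k.-1) gxs.
    by rewrite ler_sqr ?nnegrE ?(le_trans D0 h).
  apply: (le_trans (cauchy_schwarz _ _)).
  by rewrite -!enorm_sqr ler_wpM2l ?sqr_ge0.
have ma2 : m ^+ 2 <= alpha k ^+ 2.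
  by rewrite ler_sqr ?nnegrE ?(ltW m0) ?(ltW a0).
have h1 := ler_wpM2l (sqr_ge0 m) DW.
have h2 := ler_wpM2r (mulr_ge0 (sqr_ge0 (enorm (residual k))) T0) ma2.
have h3 := ler_wpM2r T0 hd.
rewrite exprMn; have := sqr_ge0 delta; lra.
Qed.

Lemma gap_cvg0 : F (x k) - F xs @[k --> \oo] --> (0 : R).
Proof.
have m0 := stepsize_bound_gt0.
pose delta k := potential xs k - potential xs k.+1.
have d0 : delta @ \oo --> (0 : R).
  rewrite -(subrr (limn (potential xs))); apply: cvgB.
    exact: potential_cvg.
  by rewrite (cvg_shiftS (potential xs)); exact: potential_cvg.
have B0 : delta k * (T2 + delta k) @[k --> \oo] --> (0 : R).
  rewrite -(mul0r (T2 + 0)); apply: cvgM => //; apply: cvgD => //.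
  exact: cvg_cst.
apply/cvgrPdist_lt => e e0.
have me0 : 0 < (m * e) ^+ 2 by rewrite exprn_gt0 // mulr_gt0.
move/cvgrPdist_lt/(_ _ me0): B0; apply: filterS => k.
rewrite !sub0r !normrN (ger0_norm (gap_ge0 k xs_min)).
move=> /(le_lt_trans (ler_norm _)).
move/(le_lt_trans (gap_sqr_le k)); rewrite ltr_sqr ?nnegrE ?ltr_pM2l //.
- by rewrite mulr_ge0 ?gap_ge0 // ltW.
- by rewrite mulr_ge0 // ltW.
Qed.

(** Along a filter converging to [p] the points [(y, F y - f y)] of the epigraph
    of [g] tend to [(p, F xs - f p)], which closedness puts in the epigraph. *)
Lemma cluster_argmin p : eclosed g -> cluster (x @ \oo) p ->
  argmin (objective f g) p.
Proof.
move=> gcl; rewrite cluster_cvgE => -[G PG [Gp xG]].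
have GF : F y @[y --> G] --> F xs.
  move=> A FA; apply: xG; rewrite /nbhs /=.
  have : F (x k) @[k --> \oo] --> F xs.
    exact: (cvg_sub0 (g := cst (F xs)) gap_cvg0 (cvg_cst _)).
  exact.
have Gf : f y @[y --> G] --> f p.
  by move=> A /(differentiable_continuous (f_diff p)); exact: Gp.
have Gg : \forall y \near G, (g y <= (F y - f y)%:E)%E.
  apply: xG; exists 0%N => // k _ /=.
  rewrite /real_objective addrAC subrr add0r fineK //; exact: iterate_fin_num.
have gp : (g p <= (F xs - f p)%:E)%E.
  apply: (closed_cvg (u_ := fun y => (y, F y - f y)) _ gcl Gg (p, F xs - f p)).
  exact: (cvg_pair (f := id) (g := fun y => F y - f y) Gp (cvgB GF Gf)).
move=> v; apply: le_trans (xs_min v); rewrite /objective.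
have gxs := argmin_objective_fin_num g_proper xs_min.
by rewrite addeC -leeBrDr // (le_trans gp) // EFinB EFinD fineK.
Qed.

(** Opial's argument: the potentials at the minimizers [p] and [q] share all
    terms but the squared distances, so [<x k, q - p>] converges; its limit is
    both [<p, q - p>] and [<q, q - p>]. *)
Lemma cluster_unique p q : eclosed g -> cluster (x @ \oo) p ->
  cluster (x @ \oo) q -> p = q.
Proof.
move=> gcl cp cq.
have pmin := cluster_argmin gcl cp; have qmin := cluster_argmin gcl cq.
have Fpq : F p = F q.
  have gpf := argmin_objective_fin_num g_proper pmin.
  have gqf := argmin_objective_fin_num g_proper qmin.
  by apply/eqP; rewrite eq_le !real_objective_le.
pose l :=
  2^-1 * (limn (potential p) - limn (potential q) - dotr p p + dotr q q).
have key k : dotr (x k.+1) (q - p) =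
    2^-1 * (potential p k - potential q k - dotr p p + dotr q q).
  rewrite /potential Fpq; set G := F (x k) - F q; set w := enorm (residual k).
  by rewrite !enorm_sqr !dotE (dotC p (x _)) (dotC q (x _)); field.
have dl : dotr y (q - p) @[y --> x @ \oo] --> l.
  have h : dotr (x k.+1) (q - p) @[k --> \oo] --> l.
    rewrite (eq_cvg _ _ key).
    apply: cvgM; first exact: cvg_cst.
    apply: cvgD; last exact: cvg_cst.
    apply: cvgB; last exact: cvg_cst.
    by apply: cvgB; exact: potential_cvg.
  by move: h; rewrite (cvg_shiftS (fun k => dotr (x k) (q - p))).
have hR : hausdorff_space R by exact: norm_hausdorff.
have pl := cluster_cvg_eq hR _ cp (@dotr_continuous _ _ (q - p) p) dl.
have ql := cluster_cvg_eq hR _ cq (@dotr_continuous _ _ (q - p) q) dl.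
have pq0 : dotr (q - p) (q - p) = 0 by rewrite dotDl dotNl pl ql subrr.
apply/esym/eqP; rewrite -subr_eq0.
by apply: contraT => /dot_gt0; rewrite pq0 ltxx.
Qed.

Lemma iterate_bounded k : `|x k| <= Num.sqrt T2 + `|xs|.
Proof.
have [_ _ b0 _ _] := adaPBB_invariant k.
rewrite -(subrK xs (x k)) (le_trans (ler_normD _ _)) // lerD2r.
apply: (le_trans (norm_le_enorm _)); apply: ler_wsqrtr.
by rewrite -enorm_sqr.
Qed.

End adaPBB_analysis.

Theorem theorem5p4 (R : realType) (n : nat)
  (f : 'rV[R]_n -> R) (g : 'rV[R]_n -> \bar R)
  (f_convex : convex_function [set: convex_lmodType 'rV[R]_n] f)
  (f_diff : forall y, differentiable f y)
  (f_grad_loclip : locally_elipschitz (gradient f))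
  (g_closed : eclosed g) (g_proper : eproper g) (g_convex : econvex g)
  (xs : 'rV[R]_n) (xs_min : argmin (objective f g) xs)
  (x : nat -> 'rV[R]_n) (xi0 : 'rV[R]_n) (alpha theta : nat -> R)
  (algo : adaPBB f g x xi0 alpha theta)
  (grad_neq : forall k : nat, (1 <= k)%N ->
    gradient f (x k) <> gradient f (x k.-1))
  (L : R) (L_gt0 : 0 < L)
  (f_smooth : smooth_on f L (ecball xs (radiusT f g x xi0 alpha xs))) :
  exists2 xbar, argmin (objective f g) xbar & x @ \oo --> xbar.
Proof.
have [p cp xp] := bounded_cvg_unique_cluster
  (iterate_bounded f_convex f_diff g_proper g_convex algo grad_neq
     xs_min L_gt0 f_smooth)
  (fun p q => cluster_unique f_convex f_diff g_proper g_convex algo grad_neq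
     xs_min L_gt0 f_smooth g_closed).
exists p => //.
exact: (cluster_argmin f_convex f_diff g_proper g_convex algo grad_neq
     xs_min L_gt0 f_smooth g_closed).
Qed.
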